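(* Let $X_{0-}$ be a real random variable with $\mathbb{E}|X_{0-}|<\infty$. For $x\in\mathbb{R}$, let $\underline{\Lambda}^x$ denote the minimal solution to the McKean--Vlasov equation (stated in the context) with initial condition $X_{0-}+x$, and let $\Lambda^0=\lim_{x\uparrow 0}\underline{\Lambda}^x$ be the left limit in $(D([-1,\infty)),\mathrm{M1})$. If $\Lambda$ is any physical solution to the McKean--Vlasov equation with initial condition $X_{0-}$, then $\Lambda^0_t\ge \Lambda_t$ for all $t\ge 0$. As a result, if $X_{0-}$ admits at least two physical solutions, then $\Lambda^0\neq\underline{\Lambda}^0$, where $\underline{\Lambda}^0$ is the minimal solution with initial condition $X_{0-}$.
   Context: Fix $\alpha>0$. For an interval $I$, $D(I)$ is the space of càdlàg functions $I\to\mathbb{R}$. Elements $f$ of $D([0,\infty))$ carry a prescribed value $f_{0-}=f(0-)$, so a jump at time $0$ is allowed. Let $$M=\{\ell\in D([0,\infty)):\ \ell_{0-}=0,\ \ell\text{ is increasing (non-decreasing)}\}.$$ McKean--Vlasov equation: given an initial condition $X_{0-}$ (a real random variable) and a Brownian motion $B$ (started at $0$) independent of $X_{0-}$, a solution with initial data $X_{0-}$ is a function $\Lambda\in M$ such that $$X_t=X_{0-}+B_t-\Lambda_t\ (t\ge0),\qquad \tau=\inf\{t\ge0:X_t\le0\},\qquad \Lambda_t=\alpha\,\mathbb{P}(\tau\le t)\ (t\ge 0).$$ At $t=0$, $X_{t-}$ means the initial condition $X_{0-}$ and $\Lambda_{0-}=0$. A solution $\Lambda\in M$ is called physical if $\Lambda_{t}-\Lambda_{t-}=\inf\{x>0:\alpha\,\mathbb{P}(\tau\ge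 t,\ X_{t-}\in(0,x])<x\}$ at all $t\ge0$. Minimal solution: for $\ell\in M$ put $X^\ell_t=X_{0-}+B_t-\ell_t$, $\tau^\ell=\inf\{t\ge0:X^\ell_t\le0\}$ and $\Gamma[\ell;X_{0-}]_t=\alpha\,\mathbb{P}(\tau^\ell\le t)$, $t\ge0$; let $\Gamma^n[\,\cdot\,;X_{0-}]$ be the $n$-fold iterate of $\Gamma[\,\cdot\,;X_{0-}]$. The minimal solution with initial data $X_{0-}$ is $\underline\Lambda=\lim_{n\to\infty}\Gamma^n[0;X_{0-}]$ (limit in the M1 topology described below). It is known to be a solution, and it is equivalently characterized as the unique solution $\underline\Lambda\in M$ with $\underline\Lambda_t\le\Lambda_t$ for all $t\ge0$ and every solution $\Lambda\in M$ with the same initial data. When $\mathbb{E}|X_{0-}|<\infty$, it is known that the minimal solution is physical. The left limit $\Lambda^0=\lim_{x\uparrow0}\underline\Lambda^x$ exists in $(D([-1,\infty)),\mathrm{M1})$, belongs to $M$, and solves the McKean--Vlasov equation with initial condition $X_{0-}$. Topology: every $f\in D([0,\infty))$ is regarded as an element of $D([-1,\infty))$ by setting $f(x)=f(0-)$ for $x\in[-1,0)$. M1 denotes the Skorokhod M1 topology. $f^n\to f$ in $(D([-1,\infty)),\mathrm{M1})$ means that there is a sequence $T_N\nearrow\infty$ such that $f^n\to f$ in $(D([-1,T_N]),\mathrm{M1})$ for all $N$. For non-decreasing functions, convergence in $(D([-1,T]),\mathrm{M1})$ is equivalent to $f^n(t)\to f(t)$ for all $t$ in a dense subset of $[-1,T]$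 containing $-1$ and $T$. *)

(* Defs.v *)
From HB Require Import structures.
From mathcomp Require Import all_boot all_order all_algebra.
From mathcomp Require Import all_classical all_reals all_analysis.

Set Implicit Arguments.
Unset Strict Implicit.
Unset Printing Implicit Defensive.

Import Order.TTheory GRing.Theory Num.Theory.
Import numFieldNormedType.Exports.

Local Open Scope classical_set_scope.
Local Open Scope ring_scope.

(* Convention: an element f of D([0,oo)) together with its prescribed value
   f(0-) is a function R -> R that takes the constant value f(0-) on the
   negative reals.  In particular f is its own extension to [-1,oo). *)

Section paths.
Context {R : realType}.
Implicit Types (f g : R -> R) (a b t : R).

Definition left_limit f t : R := lim (f x @[x --> t^'-]).

Definition cadlag f : Prop :=
  (exists c, forall t : R, t < 0 -> f t = c) /\
  (forall t : R, 0 <= t ->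
     f x @[x --> t^'+] --> f t /\ cvg (f x @[x --> t^'-])).

Definition M f : Prop :=
  [/\ cadlag f, (forall t : R, t < 0 -> f t = 0) & {homo f : s t / s <= t}].

(* On D([a,b]) there is no jump at a. *)
Definition pre_value a f t : R := if t <= a then f a else left_limit f t.

Definition completed_graph a b f : set (R * R) :=
  [set p | a <= p.1 <= b /\
     exists2 c, 0 <= c <= 1 &
       p.2 = c * pre_value a f p.1 + (1 - c) * f p.1].

Definition graph_le a f (p q : R * R) : Prop :=
  p.1 < q.1 \/
  (p.1 = q.1 /\ `|pre_value a f p.1 - p.2| <= `|pre_value a f p.1 - q.2|).

Definition parametric_representation a b f (r u : R -> R) : Prop :=
  [/\ {within `[0, 1], continuous r},
      {within `[0, 1], continuous u},
      [set (r s, u s) | s in `[0, 1]] = completed_graph a b f &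
      forall s s' : R, 0 <= s -> s <= s' -> s' <= 1 ->
        graph_le a f (r s, u s) (r s', u s')].

Definition unit_sup_dist (r u r' u' : R -> R) : \bar R :=
  ereal_sup [set (Num.max `|r s - r' s| `|u s - u' s|)%:E | s in `[0, 1]].

(* Skorokhod's M1 distance on D([a,b]) *)
Definition M1_dist a b f g : \bar R :=
  ereal_inf [set e | exists r u r' u',
    [/\ parametric_representation a b f r u,
        parametric_representation a b g r' u' &
        e = unit_sup_dist r u r' u']].

(* Convergence in (D([-1,oo)), M1) of a family (fs i) along the filter F *)
Definition M1_cvg {I : Type} (F : set_system I) (fs : I -> R -> R) f : Prop :=
  exists T : nat -> R,
    [/\ forall N, -1 < T N,
        {homo T : m n / (m <= n)%N >-> m <= n},
        T n @[n --> \oo] --> +oo &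
        forall N, M1_dist (-1) (T N) (fs i) f @[i --> F] --> 0%E].

End paths.

Section probability.
Context {R : realType} {d : measure_display} {T : measurableType d}.
Variable P : probability T R.

Definition independent_classes (F G : set (set T)) : Prop :=
  forall A A', F A -> G A' -> P (A `&` A') = (P A * P A')%E.

Definition sigma_rv (Y : T -> R) : set (set T) :=
  preimage_set_system [set: T] Y measurable.

Definition sigma_process (I : set R) (B : R -> T -> R) : set (set T) :=
  <<s \bigcup_(t in I) sigma_rv (B t) >>.

(* Standard Brownian motion started at 0; only the times t >= 0 matter. *)
Definition brownian_motion (B : R -> {RV P >-> R}) : Prop :=
  [/\ forall w, B 0 w = 0,
      forall w, {within `[0, +oo[, continuous (fun t : R => B t w)},
      forall s t : R, 0 <= s -> s < t ->
        independent_classes (sigma_process `[0, s] (fun r => B r))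
          (sigma_rv (fun w => B t w - B s w)) &
      forall s t : R, 0 <= s -> s < t -> forall U : set R, measurable U ->
        P ((fun w => B t w - B s w) @^-1` U)
          = normal_prob 0 (Num.sqrt (t - s)) U].

Definition independent_of_process (Y : T -> R) (B : R -> {RV P >-> R}) : Prop :=
  independent_classes (sigma_rv Y) (sigma_process `[0, +oo[ (fun t => B t)).

End probability.

Section mckean_vlasov.
Context {R : realType} {d : measure_display} {T : measurableType d}.
Variables (P : probability T R) (alpha : R) (B : R -> {RV P >-> R}).
Implicit Types (xi : T -> R) (l : R -> R).

(* xi is the initial condition X_{0-}; the value at negative times encodes
   the left limit X_{0-} at time 0, as for paths. *)
Definition X xi l (t : R) (w : T) : R :=
  if t < 0 then xi w else xi w + B t w - l t.

Definition tau xi l (w : T) : \bar R :=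
  ereal_inf [set t%:E | t in [set t : R | 0 <= t /\ X xi l t w <= 0]].

(* As tau >= 0, this vanishes for t < 0. *)
Definition Gamma xi l (t : R) : R :=
  alpha * fine (P [set w | (tau xi l w <= t%:E)%E]).

Definition solution xi l : Prop :=
  M l /\ forall t : R, 0 <= t -> l t = Gamma xi l t.

Definition physical_solution xi l : Prop :=
  solution xi l /\
  forall t : R, 0 <= t ->
    l t - left_limit l t =
    inf [set x : R | 0 < x /\
      alpha * fine (P [set w | (t%:E <= tau xi l w)%E /\
        0 < left_limit (fun s => X xi l s w) t <= x]) < x].

Definition minimal_solution xi l : Prop :=
  cadlag l /\ M1_cvg \oo (fun n => iter n (Gamma xi) (fun=> 0)) l.

End mckean_vlasov.

(* Main.v *)
(* Only the continuity of the Brownian paths is used.  Let L be a physical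
   solution for X0 and l the minimal solution for X0 + x with x < 0.  As the
   limit of the iterates of Gamma, l satisfies Gamma[l; X0 - e] <= l for
   e = -x/2.  As long as L < l + e, the particle started from X0 - e and driven
   by l stays below the one started from X0 and driven by L, hence is absorbed
   earlier, and L <= l.  If t is the first time with L >= l + e, then L jumps at t
   by at least z = l t + e - L (t-), so physicality puts mass at least z / alpha
   on the particles alive with X_{t-} in (0, z]; all these are absorbed by time t
   in the lower system, which gives l t >= L (t-) + z = l t + e, a
   contradiction.  The bound L <= l survives the M1 limit x -> 0-. *)
Require Import Defs.
From mathcomp Require Import all_boot all_order all_algebra.
From mathcomp Require Import all_classical all_reals all_analysis.
From mathcomp Require Import measurable_realfun lra.
Import Order.TTheory GRing.Theory Num.Theory.
Import numFieldNormedType.Exports.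
Local Open Scope classical_set_scope.
Local Open Scope ring_scope.

Set Implicit Arguments.
Unset Strict Implicit.
Unset Printing Implicit Defensive.

(** * Right continuity and left limits of nondecreasing paths *)

Section monotone_paths.
Context {R : realType}.
Implicit Types (f g l : R -> R) (s t e : R).

(** M1 estimates compare values at slightly shifted times, so a bound is first proved at every later
    [u] and then brought back to [t] by right continuity. *)
Lemma le_of_right f (c t : R) :
  (forall e, 0 < e -> exists2 u, t < u & f u < f t + e) ->
  (forall u, t < u -> c <= f u) -> c <= f t.
Proof.
move=> fr cf; apply/ler_addgt0Pr => e e0.
by have [u tu fu] := fr e e0; rewrite (le_trans (cf u tu))// ltW.
Qed.

Lemma right_modulus f t e : f x @[x --> t^'+] --> f t -> 0 < e ->
  exists2 u, t < u & forall r, t < r < u -> `|f t - f r| < e.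
Proof.
move=> /cvgrPdist_lt ft e0; have [d /= d0 H] := ft e e0.
exists (t + d); first by rewrite ltrDl.
move=> r /andP[tr rd]; apply: H => //=.
by rewrite distrC gtr0_norm ?subr_gt0// ltrBlDl.
Qed.

Lemma cadlag_right f t : cadlag f -> f x @[x --> t^'+] --> f t.
Proof.
move=> [[c fc] ft]; have [t0|/ft[]//] := ltP t 0.
rewrite (fc t)//; apply: cvg_near_cst; near=> x.
by apply: fc; near: x; exact: nbhs_right_lt.
Unshelve. all: by end_near. Qed.

Lemma M_right l t e : M l -> 0 < e -> exists2 u, t < u & l u < l t + e.
Proof.
move=> [lc _ lm] e0.
have [u tu H] := right_modulus (cadlag_right (t:=t) lc) e0.
have tm : t < (t + u) / 2 < u by rewrite midf_lt//= midf_lt.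
exists ((t + u) / 2); first by case/andP: tm.
have := H _ tm; rewrite ltr_norml => /andP[]; lra.
Qed.

Lemma M_left_is_cvg l t : {homo l : s t / s <= t} -> cvg (l x @[x --> t^'-]).
Proof.
move=> lm; apply: nondecreasing_at_left_is_cvgr.
  by near=> x => y z _ _; exact: lm.
near=> x; exists (l t) => _ /= [y + <-].
by rewrite in_itv/= => /andP[_ /ltW]; exact: lm.
Unshelve. all: by end_near. Qed.

Lemma left_limit_ge l s t : {homo l : s t / s <= t} -> s < t ->
  l s <= left_limit l t.
Proof.
move=> lm st; apply: limr_ge; first exact: M_left_is_cvg.
near=> x; apply: lm; near: x; exact: nbhs_left_ge.
Unshelve. all: by end_near. Qed.

Lemma left_limit_le l t c : {homo l : s t / s <= t} ->
  (forall s, s < t -> l s <= c) -> left_limit l t <= c.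
Proof.
move=> lm lc; apply: limr_le; first exact: M_left_is_cvg.
near=> x; apply: lc; near: x; exact: nbhs_left_lt.
Unshelve. all: by end_near. Qed.

(** Monotonicity squeezes the values just after [t] between [l t] and [l u], so one point [u] per
    [e] yields right continuity; left limits come from monotonicity. *)
Lemma M_intro l : (forall t, t < 0 -> l t = 0) -> {homo l : s t / s <= t} ->
  (forall t e, 0 < e -> exists2 u, t < u & l u < l t + e) -> M l.
Proof.
move=> l0 lm lr; split=> //; split; first by exists 0.
move=> t t0; split; last exact: M_left_is_cvg.
apply/cvgrPdist_lt => e e0; have [u tu lu] := lr t e e0.
near=> x; have tx : t <= x by near: x; exact: nbhs_right_ge.
have xu : x <= u by near: x; exact: nbhs_right_le.
rewrite distrC ger0_norm ?subr_ge0 ?lm// ltrBlDl.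
exact: le_lt_trans (lm _ _ xu) lu.
Unshelve. all: by end_near. Qed.

(** * M1 convergence of nondecreasing functions, reduced to pointwise bounds *)

Lemma completed_graph_bounds a b l r v : {homo l : s t / s <= t} ->
  completed_graph a b l (r, v) ->
  a <= r <= b /\ (forall q, q < r -> l q <= v) /\ v <= l r.
Proof.
move=> lm [/= arb [c /andP[c0 c1] ->]]; split=> //.
have [ar _] := andP arb.
have prer : pre_value a l r <= l r.
  rewrite /pre_value; case: ifP => _; first exact: lm.
  by apply: left_limit_le => // s /ltW; exact: lm.
split=> [q qr|]; last first.
  have := ler_wpM2l c0 prer; lra.
have preq : l q <= pre_value a l r.
  rewrite /pre_value; case: ifP => ra; last exact: left_limit_ge.
  by apply: lm; lra.
have := ler_wpM2l c0 preq.
have c1' : 0 <= 1 - c by rewrite subr_ge0.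
have := ler_wpM2l c1' (lm _ _ (ltW qr)); lra.
Qed.

(** Two parametrizations at distance below [e] match [(t, g t)] with a point of the completed graph
    of [f] less than [e] away in both coordinates, and monotonicity of [f] bounds the height of that
    point. *)
Lemma M1_dist_bounds a b f g t e : {homo f : s t / s <= t} ->
  (M1_dist a b f g < e%:E)%E -> a <= t <= b ->
  f (t - e) - e <= g t <= f (t + e) + e.
Proof.
move=> fm /ereal_inf_lt[_ [r [u [r' [u' [[_ _ fru _] [_ _ gru _] ->]]]]] due].
move=> atb.
have : completed_graph a b g (t, g t).
  split=> //=; exists 0; first by rewrite lexx ler01.
  by rewrite mul0r add0r subr0 mul1r.
rewrite -gru => -[s s01 [rs us]].
have : completed_graph a b f (r s, u s) by rewrite -fru; exists s.
move=> /(completed_graph_bounds fm)[_ [Hl Hu]].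
have : Num.max `|r s - r' s| `|u s - u' s| < e.
  rewrite -lte_fin (le_lt_trans _ due)//; apply: ereal_sup_ubound.
  by exists s.
rewrite gt_max rs us !ltr_norml => /andP[/andP[r1 r2] /andP[u1 u2]].
have H1 : f (t - e) <= u s by apply: Hl; lra.
have H2 : f (r s) <= f (t + e) by apply: fm; lra.
by apply/andP; split; lra.
Qed.

(** The form in which M1 convergence enters all later arguments: slack [e] in time and in value. *)
Lemma M1_cvg_bounds {I : Type} (F : set_system I) {FF : Filter F}
    (fs : I -> R -> R) f t e :
  M1_cvg F fs f -> (forall i, M (fs i)) -> -1 <= t -> 0 < e ->
  \forall i \near F, fs i (t - e) - e <= f t <= fs i (t + e) + e.
Proof.
move=> [S [_ _ Soo cv]] fM t1 e0.
have [N _ /(_ N (leqnn N)) /= HN] := (cvgryPge _).1 Soo t.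
have := cv N => /(_ [set x | (x < e%:E)%E]).
have H : nbhs (0%E : \bar R) [set x | (x < e%:E)%E].
  apply: open_nbhs_nbhs; split; first exact: open_ereal_lt_ereal.
  by rewrite /= lte_fin.
move=> /(_ H); apply: (@filterS _ F) => i /= d.
by apply: M1_dist_bounds d _; [case: (fM i)|rewrite t1].
Qed.

Lemma M1_cvg_M {I : Type} (F : set_system I) {FF : ProperFilter F}
    (fs : I -> R -> R) f :
  M1_cvg F fs f -> (forall i, M (fs i)) -> cadlag f -> M f.
Proof.
move=> cv fM fc.
have bounds t e : -1 <= t -> 0 < e ->
    exists i, fs i (t - e) - e <= f t <= fs i (t + e) + e.
  by move=> t1 e0; exact: filter_ex (M1_cvg_bounds cv fM t1 e0).
have f0 t : t < 0 -> f t = 0.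
  have [[c fc0] _] := fc; move=> t0.
  (* By constancy on negative times, [-(1/2)] may stand for [t]; shifts by at most 1/4 keep it
     negative, where every [fs i] vanishes. *)
  rewrite fc0// -(fc0 (-(1/2))); last by lra.
  have small e : 0 < e -> `|f (-(1/2))| <= e.
    move=> e0; have m0 : 0 < Num.min e (1/4) by rewrite lt_min e0; lra.
    have [i] := bounds (-(1/2)) _ ltac:(lra) m0.
    have m4 : Num.min e (1/4) <= 1/4 by rewrite ge_min lexx orbT.
    have [_ fi0 _] := fM i; rewrite !fi0; [|lra..].
    rewrite ler_norml; have : Num.min e (1/4) <= e by rewrite ge_min lexx.
    by move=> ? /andP[? ?]; apply/andP; split; lra.
  apply/eqP; rewrite -normr_le0; apply/ler_addgt0Pr => e e0.
  by rewrite add0r small.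
have mono s t : -1 <= s -> s < t -> f s <= f t.
  move=> s1 st; apply/ler_addgt0Pr => e e0.
  (* A time slack of at most half the gap keeps [s + m <= t - m]. *)
  have m0 : 0 < Num.min (e / 2) ((t - s) / 2) by rewrite lt_min; lra.
  have me : Num.min (e / 2) ((t - s) / 2) <= e / 2 by rewrite ge_min lexx.
  have mt : Num.min (e / 2) ((t - s) / 2) <= (t - s) / 2.
    by rewrite ge_min lexx orbT.
  move: (Num.min _ _) m0 me mt => m m0 me mt.
  have t1 : -1 <= t by lra.
  have bound r : -1 <= r ->
      F (fun i => fs i (r - m) - m <= f r <= fs i (r + m) + m).
    by move=> r1; exact (M1_cvg_bounds cv fM r1 m0).
  have [i [/andP[_ H1] /andP[H2 _]]] :=
    filter_ex (filterI (bound _ s1) (bound _ t1)).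
  have [_ _ fim] := fM i.
  have : fs i (s + m) <= fs i (t - m) by apply: fim; lra.
  lra.
split=> // s t; rewrite le_eqVlt => /predU1P[->//|st].
have [s0|s0] := ltP s 0; last by apply: mono; lra.
have [t0|t0] := ltP t 0; first by rewrite !f0.
by rewrite f0// -(f0 (-(1/2))); [apply: mono; lra|lra].
Qed.

Lemma path_modulus (b : R -> R) s e : {within `[0, +oo[, continuous b} ->
  0 <= s -> 0 < e ->
  exists2 d, 0 < d & forall r, 0 <= r -> `|s - r| < d -> `|b s - b r| < e.
Proof.
move=> /subspace_continuousP bc s0 e0.
have /bc/cvgrPdist_lt/(_ e e0) : `[0, +oo[%classic s by rewrite /= in_itv/= s0.
move=> [d /= d0 H]; exists d => // r r0 rd; apply: H => //=.
by rewrite in_itv/= r0.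
Qed.

(** * Hitting of zero by a continuous path minus a nondecreasing one *)

Section hitting.
Variables (x : R) (b l : R -> R).
Hypothesis bc : {within `[0, +oo[, continuous b}.
Let Y t := x + b t - l t.

(** A right-continuous nondecreasing [l] is upper semicontinuous, so subtracting it leaves [Y] lower
    semicontinuous. *)
Lemma path_lower_semicontinuous s e : M l -> 0 <= s -> 0 < e ->
  exists2 d, 0 < d & forall r, 0 <= r -> `|s - r| < d -> Y s - e < Y r.
Proof.
move=> lM s0 e0; have e20 : 0 < e / 2 by lra.
have [d d0 bd] := path_modulus bc s0 e20.
have [u su lu] := M_right s lM e20; have [_ _ lm] := lM.
exists (Num.min d (u - s)); first by rewrite lt_min d0 subr_gt0.
move=> r r0; rewrite lt_min => /andP[/bd-/(_ r0)] + /ltr_normlP[ru _].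
rewrite ltr_norml /Y => /andP[b1 b2].
have : l r <= l u by apply: lm; lra.
lra.
Qed.

Lemma path_right_upper s e : {homo l : s t / s <= t} -> 0 <= s -> 0 < e ->
  exists2 d, 0 < d & forall r, s <= r < s + d -> Y r < Y s + e.
Proof.
move=> lm s0 e0; have [d d0 bd] := path_modulus bc s0 e0.
exists d => // r /andP[sr rd].
have : `|b s - b r| < e by apply: bd; [lra|rewrite ltr_norml; lra].
have := lm _ _ sr; rewrite ltr_norml /Y; lra.
Qed.

(** By lower semicontinuity, [Y <= 0] persists at the infimum of the times where it holds. *)
Lemma hitting_time_attained t : M l ->
  (ereal_inf [set s%:E | s in [set s : R | (0 <= s)%R /\ (Y s <= 0)%R]] <= t%:E)%E <->
  exists2 s, 0 <= s <= t & Y s <= 0.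
Proof.
move=> lM; split=> [|[s /andP[s0 st] Ys]]; last first.
  by apply: ereal_inf_le; exists s%:E; [exists s|rewrite lee_fin].
set E := [set s : R | _] => inft.
have E0 : E !=set0.
  apply/set0P/eqP => E0; move: inft.
  by rewrite E0 image_set0 ereal_inf0 leye_eq.
have lE : has_lbound E by exists 0 => s [].
have infE : 0 <= inf E by apply: lb_le_inf => // s [].
have iE : Y (inf E) <= 0.
  rewrite leNgt; apply/negP => Y0.
  have [d d0 Hd] := path_lower_semicontinuous lM infE Y0.
  have [s [s0 Ys] sd] := inf_adherent d0 (conj E0 lE).
  have : Y (inf E) - Y (inf E) < Y s.
    apply: Hd => //; have : inf E <= s by apply: ge_inf.
    by move=> ?; rewrite ltr_norml; lra.
  lra.
exists (inf E) => //; rewrite infE/= -lee_fin (le_trans _ inft)//.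
by apply/ereal_infP => _ [s Es <-]; rewrite lee_fin; exact: ge_inf.
Qed.

(** A countable description, for measurability. Just after a hitting time [Y] stays small, so
    rationals detect the hit; conversely, if [Y > 0] on the compact interval, lower semicontinuity
    gives a uniform positive lower bound. *)
Lemma hit_rational t : M l -> 0 <= t ->
  (exists2 s, 0 <= s <= t & Y s <= 0) <->
  forall n : nat, Y t < n.+1%:R^-1 \/
    exists q : rat, 0 <= (ratr q : R) <= t /\ Y (ratr q) < n.+1%:R^-1.
Proof.
move=> lM t0; split=> [[s /andP[s0 st] Ys] n|H].
  have n0 : 0 < n.+1%:R^-1 :> R by rewrite invr_gt0.
  (* A hit at [t] itself has no rational of [[0, t]] to its right, hence the separate condition on
     [Y t]. *)
  move: st; rewrite le_eqVlt => /predU1P[<-|st].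
    by left; apply: le_lt_trans n0.
  right; have [_ _ lm] := lM.
  have [d d0 Hd] := path_right_upper lm s0 n0.
  have sm : s < Num.min (s + d) t by rewrite lt_min st andbT; lra.
  have [q] := rat_in_itvoo sm; rewrite in_itv/= lt_min => /and3P[sq qd qt].
  exists q; split; first by lra.
  have /lt_le_trans : Y (ratr q) < Y s + n.+1%:R^-1 by apply: Hd; rewrite ltW.
  by apply; rewrite gerDr.
apply: contrapT => /forall2NP noroot.
have Ypos s : 0 <= s <= t -> 0 < Y s.
  by move=> st; have [//|/negP] := noroot s; rewrite -ltNge.
have /compact_near_coveringP/near_covering_withinP cov := @segment_compact R 0 t.
have : \forall n \near \oo, `[0, t] `<=` [set r | n.+1%:R^-1 <= Y r].
  apply: cov => s; rewrite /= in_itv/= => st.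
  have Y20 : 0 < Y s / 2 by have := Ypos _ st; lra.
  have [s0 _] := andP st.
  have [d d0 Hd] := path_lower_semicontinuous lM s0 Y20.
  exists (ball s d, [set n | n.+1%:R^-1 < Y s / 2]) => /=.
    by split; [exact: nbhsx_ballx|exact: near_infty_natSinv_lt (PosNum Y20)].
  move=> [r n] /= [sr nY]; rewrite in_itv/= => /andP[r0 _].
  have Yr : Y s / 2 < Y r by have := Hd r r0 sr; lra.
  exact: ltW (lt_trans nY Yr).
move=> /filter_ex[n Hn].
have {}Hn r : 0 <= r <= t -> n.+1%:R^-1 <= Y r.
  by move=> rt; apply: Hn; rewrite /= in_itv.
have [|[q [/Hn]]] := H n; rewrite ltNge; last by move=> ->.
by rewrite Hn // t0 lexx.
Qed.

End hitting.

End monotone_paths.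

(** * Absorption events and their measurability *)

Section mckean_vlasov.
Context {R : realType} {d : measure_display} {T : measurableType d}.
Variables (P : probability T R) (alpha : R) (B : R -> {RV P >-> R}).
Hypothesis alpha_gt0 : 0 < alpha.
Hypothesis B0 : forall w, B 0 w = 0.
Hypothesis Bc : forall w, {within `[0, +oo[, continuous (fun t : R => B t w)}.
Arguments Bc : clear implicits.
Implicit Types (xi : T -> R) (l L : R -> R) (s t : R).

Definition hit xi l t : set T :=
  [set w | exists2 s, 0 <= s <= t & xi w + B s w - l s <= 0].

Lemma hit_lt0 xi l t : t < 0 -> hit xi l t = set0.
Proof. by move=> t0; apply/seteqP; split=> // w [s]; lra. Qed.

(** Both systems are driven by the same noise, so [B] cancels and the comparison is pathwise. *)
Lemma subset_hit xi l xi' l' s t : s <= t ->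
  (forall w r, 0 <= r <= s -> xi' w - l' r <= xi w - l r) ->
  hit xi l s `<=` hit xi' l' t.
Proof.
move=> st H w [r /andP[r0 rs] Hr]; exists r; first lra.
have := H w r; rewrite r0 rs => /(_ isT); lra.
Qed.

Lemma X_ge0 xi l t w : 0 <= t -> X B xi l t w = xi w + B t w - l t.
Proof. by rewrite /X leNgt => /negbTE ->. Qed.

Lemma tau_hit xi l t : M l -> [set w | (tau B xi l w <= t%:E)%E] = hit xi l t.
Proof.
move=> lM; apply: eq_set => w; rewrite /tau.
rewrite (_ : [set t | _] = [set s : R | 0 <= s /\ xi w + B s w - l s <= 0]).
  by apply/propext; exact: hitting_time_attained.
by apply/seteqP; split=> s /= [s0]; rewrite X_ge0.
Qed.

Lemma le_tau xi l t w : (t%:E <= tau B xi l w)%E <->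
  forall s, 0 <= s < t -> 0 < xi w + B s w - l s.
Proof.
split=> [/ereal_infP H s /andP[s0 st]|H].
  rewrite ltNge; apply/negP => Xs.
  have := H s%:E; rewrite lee_fin leNgt st => /(_ _)/negP; apply => //.
  by exists s => //; rewrite /= X_ge0.
apply/ereal_infP => _ [s [s0 Xs] <-]; rewrite lee_fin leNgt; apply/negP => st.
by move: Xs; rewrite X_ge0// leNgt H// s0.
Qed.

Lemma measurable_path xi l s (D : set R) : measurable_fun setT xi ->
  measurable D -> measurable [set w | D (xi w + B s w - l s)].
Proof.
move=> mxi mD; have mf : measurable_fun setT (fun w => xi w + B s w - l s).
  apply: measurable_funB; last exact: measurable_cst.
  exact: measurable_funD.
by rewrite -[X in measurable X]setTI; exact: mf.
Qed.

Lemma measurable_hit xi l t : measurable_fun setT xi -> M l ->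
  measurable (hit xi l t).
Proof.
move=> mxi lM; have [t0|t0] := ltP t 0.
  by rewrite hit_lt0.
have Y_lt s (n : nat) :
    measurable [set w | xi w + B s w - l s < n.+1%:R^-1].
  have := @measurable_path xi l s `]-oo, n.+1%:R^-1[ mxi (measurable_itv _).
  by under eq_set do rewrite /= in_itv/=.
rewrite (_ : hit xi l t =
    \bigcap_n ([set w | xi w + B t w - l t < n.+1%:R^-1] `|`
      \bigcup_(q in [set q : rat | 0 <= (ratr q : R) <= t])
        [set w | xi w + B (ratr q) w - l (ratr q) < n.+1%:R^-1])).
  apply: bigcapT_measurable => n; apply: measurableU => //.
  rewrite bigcup_mkcond; apply: bigcupT_measurable_rat => q.
  by case: ifP => _; [exact: Y_lt|exact: measurable0].
apply/seteqP; split=> w /=.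
  move=> /(hit_rational (xi w) (Bc w) lM t0) H n _.
  by have [|[q [q1 q2]]] := H n; [left|right; exists q].
move=> H; apply/(hit_rational (xi w) (Bc w) lM t0) => n.
by have [|[q q1 q2]] := H n I; [left|right; exists q].
Qed.

(** Survival up to [t] means no absorption by [t - n.+1%:R^-1] for any [n]; when that time is
    negative the event [hit] is empty. *)
Lemma measurable_le_tau xi l t : measurable_fun setT xi -> M l ->
  measurable [set w | (t%:E <= tau B xi l w)%E].
Proof.
move=> mxi lM.
rewrite (_ : [set w | _] = \bigcap_(n : nat) ~` hit xi l (t - n.+1%:R^-1)).
  by apply: bigcapT_measurable => n; exact/measurableC/measurable_hit.
apply/seteqP; split=> w /=.
  move=> /le_tau H n _ [s /andP[s0 sn]]; apply/negP; rewrite -ltNge; apply: H.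
  by rewrite s0 (le_lt_trans sn)// gtrBl invr_gt0.
move=> H; apply/le_tau => s /andP[s0 st]; rewrite ltNge; apply/negP => Ys.
have ts0 : 0 < t - s by rewrite subr_gt0.
have [n Hn] := filter_ex (near_infty_natSinv_lt (PosNum ts0)).
apply: (H n I); exists s => //; rewrite s0/= lerBrDl -lerBrDr; exact: ltW.
Qed.

(** * Monotonicity and regularity of the operator [Gamma] *)

Let p (A : set T) : R := fine (P A).

Let pE A : measurable A -> P A = (p A)%:E.
Proof. by move=> mA; rewrite fineK// fin_num_measure. Qed.

Let p_le A A' : measurable A -> measurable A' -> A `<=` A' -> p A <= p A'.
Proof.
by move=> mA mA' AA'; rewrite -lee_fin -!pE// le_measure// inE.
Qed.

Let p_add A A' : measurable A -> measurable A' -> [disjoint A & A'] ->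
  p (A `|` A') = p A + p A'.
Proof.
move=> mA mA' /disj_setPS AA'; apply: EFin_inj.
rewrite EFinD -!pE//; last exact: measurableU.
by rewrite measureU// -subset0.
Qed.

Lemma Gamma_hit xi l t : M l -> Gamma alpha B xi l t = alpha * p (hit xi l t).
Proof. by move=> lM; rewrite /Gamma tau_hit. Qed.

Lemma Gamma_lt0 xi l t : M l -> t < 0 -> Gamma alpha B xi l t = 0.
Proof. by move=> lM t0; rewrite Gamma_hit// hit_lt0// /p measure0 mulr0. Qed.

Lemma Gamma_le xi l s xi' l' t : measurable_fun setT xi -> M l ->
  measurable_fun setT xi' -> M l' -> hit xi l s `<=` hit xi' l' t ->
  Gamma alpha B xi l s <= Gamma alpha B xi' l' t.
Proof.
move=> mxi lM mxi' lM' H; rewrite !Gamma_hit// ler_pM2l//.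
by apply: p_le => //; exact: measurable_hit.
Qed.

(** Right continuity is continuity of [P] from above: since [hit] is the event [tau <= t], the
    events at times [t + n.+1%:R^-1] decrease to the one at [t]. *)
Lemma Gamma_M xi l : measurable_fun setT xi -> M l -> M (Gamma alpha B xi l).
Proof.
move=> mxi lM; have mh t : measurable (hit xi l t) by exact: measurable_hit.
apply: M_intro => [t|s t st|t e e0].
- exact: Gamma_lt0.
- by apply: Gamma_le => //; exact: subset_hit.
- pose F (n : nat) := hit xi l (t + n.+1%:R^-1).
  have capF : \bigcap_n F n = hit xi l t.
    rewrite -tau_hit//; apply/seteqP; split=> w /= Hw.
      apply/lee_addgt0Pr => c c0.
      have [n Hn] := filter_ex (near_infty_natSinv_lt (PosNum c0)).
      have := Hw n I; rewrite /F -tau_hit//= => /le_trans; apply.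
      by rewrite -EFinD lee_fin lerD2l ltW.
    move=> n _; rewrite /F -tau_hit//=; apply: le_trans Hw _.
    by rewrite lee_fin lerDl.
  have : p (F n) @[n --> \oo] --> p (hit xi l t).
    apply: fine_cvg; rewrite -pE// -capF.
    apply: nonincreasing_cvg_mu.
    + by rewrite (le_lt_trans (probability_le1 _ _)) ?ltry//; exact: mh.
    + by move=> n; exact: mh.
    + by rewrite capF.
    + move=> m n mn; apply/subsetPset; apply: subset_hit => //.
      by rewrite lerD2l lef_pV2 ?posrE// ler_nat.
  move=> /cvgr_lt/(_ (p (hit xi l t) + e / alpha)); rewrite ltrDl divr_gt0//.
  move=> /(_ isT)/filter_ex[n Hn].
  exists (t + n.+1%:R^-1); first by rewrite ltrDl.
  rewrite !Gamma_hit//.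
  by rewrite -(@ltr_pM2l _ alpha)// mulrDr (mulrC e) mulVKf ?gt_eqF in Hn.
Qed.

Lemma M_cst0 : M (fun=> 0 : R).
Proof.
apply: M_intro => // t e e0; exists (t + 1); first by rewrite ltrDl.
by rewrite add0r.
Qed.

Lemma iter_Gamma_M xi n : measurable_fun setT xi ->
  M (iter n (Gamma alpha B xi) (fun=> 0)).
Proof. by move=> mxi; elim: n => [|n IH]; [exact: M_cst0|exact: Gamma_M]. Qed.

(** * The minimal solution as a limit of iterates *)

Lemma minimal_solution_M xi l : measurable_fun setT xi ->
  minimal_solution alpha B xi l -> M l.
Proof.
move=> mxi [lc cv]; apply: M1_cvg_M cv _ lc => n; exact: iter_Gamma_M.
Qed.

Lemma solution_Gamma xi L t : solution alpha B xi L ->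
  L t = Gamma alpha B xi L t.
Proof.
move=> [LM LG]; have [t0|/LG//] := ltP t 0.
by rewrite Gamma_lt0//; case: LM => _ ->.
Qed.

(** By monotonicity of [Gamma] and induction from 0, every iterate stays below [L]; right continuity
    of [L] absorbs the time slack of the M1 limit. *)
Lemma minimal_solution_le xi l L t : measurable_fun setT xi ->
  minimal_solution alpha B xi l -> solution alpha B xi L -> l t <= L t.
Proof.
move=> mxi lmin Lsol; have [LM _] := Lsol; have [_ _ Lm] := LM.
have [_ L0 _] := LM.
have lM := minimal_solution_M mxi lmin; have [_ cv] := lmin.
have iterL n s : iter n (Gamma alpha B xi) (fun=> 0) s <= L s.
  elim: n s => [s|n IH s] /=.
    have [s0|s0] := ltP s 0; first by rewrite L0.
    by rewrite -(L0 (-1)) ?ltrN10//; apply: Lm; lra.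
  rewrite (solution_Gamma s Lsol); apply: Gamma_le => //.
    exact: iter_Gamma_M.
  by apply: subset_hit => // w r _; rewrite lerD2l lerN2.
have [t1|t1] := ltP t 0; first by have [_ -> // _] := lM; rewrite L0.
apply/ler_addgt0Pr => e e0.
have e20 : 0 < e / 2 by lra.
have [u tu Lu] := M_right t LM e20.
have m0 : 0 < Num.min (e / 2) (u - t) by rewrite lt_min e20 subr_gt0.
have me : Num.min (e / 2) (u - t) <= e / 2 by rewrite ge_min lexx.
have mu : Num.min (e / 2) (u - t) <= u - t by rewrite ge_min lexx orbT.
have tN1 : -1 <= t by lra.
have [n /andP[_ Hn]] := filter_ex
  (M1_cvg_bounds cv (fun n => iter_Gamma_M n mxi) tN1 m0).
have := iterL n (t + Num.min (e / 2) (u - t)).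
have : L (t + Num.min (e / 2) (u - t)) <= L u by apply: Lm; lra.
lra.
Qed.

(* That [l] solves the equation for [xi] itself rests on Brownian motion
   crossing every level it hits; the shift by [y] gives room to do without. *)
Lemma minimal_solution_supersolution xi y l t : measurable_fun setT xi ->
  minimal_solution alpha B xi l -> 0 < y ->
  Gamma alpha B (fun w => xi w + y) l t <= l t.
Proof.
move=> mxi lmin y0; have lM := minimal_solution_M mxi lmin.
have [_ cv] := lmin; have [_ l0 _] := lM.
have [t0|t0] := ltP t 0; first by rewrite Gamma_lt0// l0.
set g := fun n => _ in cv; have gM n : M (g n) by exact: iter_Gamma_M.
apply: le_of_right => [e e0|u tu]; first exact: M_right.
pose m := (t + u) / 2.
have tm : t < m by rewrite /m; lra.
have mu : m < u by rewrite /m; lra.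
pose A n := hit xi (g n) m.
have mA n : measurable (A n) by exact: measurable_hit.
(* The events [C N] increase in [N], and their union is the lower limit of the events [A n]. *)
pose C N := \bigcap_(n in [set n | (N <= n)%N]) A n.
have mC N : measurable (C N) by apply: bigcap_measurable => //; exists N => /=.
have hitC : hit (fun w => xi w + y) l t `<=` \bigcup_N C N.
  move=> w [s /andP[s0 st] Ys].
  have y30 : 0 < y / 3 by lra.
  have [D D0 HD] := path_modulus (Bc w) s0 y30.
  (* The noise moves by less than [y / 3] between [s] and [s + c], and the M1 error is at most
     [y / 3]; the shift [y] covers both. The bound [m - t] keeps [s + c <= m]. *)
  pose c := Num.min (D / 2) (Num.min (y / 3) (m - t)).
  have c0 : 0 < c by rewrite !lt_min y30; lra.
  have cD : c <= D / 2 by rewrite ge_min lexx.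
  have cy : c <= y / 3 by rewrite !ge_min lexx orbT.
  have cm : c <= m - t by rewrite !ge_min lexx !orbT.
  have sN1 : -1 <= s by lra.
  have [N _ HN] := M1_cvg_bounds cv gM sN1 c0.
  exists N => // n /= Nn; exists (s + c); first lra.
  have /andP[_ gs] := HN n Nn.
  have : `|B s w - B (s + c) w| < y / 3.
    by apply: HD; [lra|rewrite ltr_norml; lra].
  rewrite ltr_norml; lra.
apply/ler_addgt0Pr => e e0.
have PC N : (P (C N) <= ((l u + e) / alpha)%:E)%E.
  have k0 : 0 < Num.min e (u - m) by rewrite lt_min e0 subr_gt0.
  have ke : Num.min e (u - m) <= e by rewrite ge_min lexx.
  have km : Num.min e (u - m) <= u - m by rewrite ge_min lexx orbT.
  have uN1 : -1 <= u by lra.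
  have [N' _ HN'] := M1_cvg_bounds cv gM uN1 k0.
  pose n := maxn N N'.
  (* The mass of [A n] is read off the next iterate, [g n.+1 = Gamma (g n)], hence the index
     [n.+1]. *)
  have /andP[gu _] := HN' n.+1 (leqW (leq_maxr _ _)).
  have gn : g n.+1 m = alpha * p (A n) by rewrite -Gamma_hit.
  have [_ _ /(_ m (u - Num.min e (u - m)))] := gM n.+1.
  rewrite gn => /(_ ltac:(lra)) Anu.
  rewrite pE// lee_fin ler_pdivlMr// mulrC.
  have : alpha * p (C N) <= alpha * p (A n).
    by rewrite ler_pM2l//; apply: p_le => // w; apply; exact: leq_maxl.
  lra.
have mUC : measurable (\bigcup_N C N) by exact: bigcup_measurable.
have : (P (\bigcup_N C N) <= ((l u + e) / alpha)%:E)%E.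
  have cvP : P (C N) @[N --> \oo] --> P (\bigcup_N C N).
    apply: nondecreasing_cvg_mu => // N N' NN'; apply/subsetPset => w CN n /= Nn.
    by apply: CN => /=; exact: leq_trans Nn.
  rewrite -(cvg_lim _ cvP)//; apply: lime_le; last exact: nearW.
  by apply/cvg_ex; eexists; exact: cvP.
rewrite pE// lee_fin ler_pdivlMr// mulrC; apply: le_trans.
rewrite Gamma_hit// ler_pM2l//; apply: p_le => //.
by apply: measurable_hit => //; exact: measurable_funD.
Qed.

(** * Comparison with physical solutions *)

Lemma left_limit_X xi l t w : M l -> 0 <= t ->
  left_limit (fun s => X B xi l s w) t = xi w + B t w - left_limit l t.
Proof.
move=> [_ l0 lm]; rewrite le_eqVlt => /predU1P[<-|t0].
  (* At time 0 the left limits are those of the constants [xi w] and 0 taken at negative times. *)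
  rewrite B0 addr0 (_ : left_limit l 0 = 0) ?subr0; apply: cvg_lim => //.
    apply: cvg_near_cst; near=> s; rewrite /X ifT//.
  apply: cvg_near_cst; near=> s; apply: l0.
  by near: s; exact: nbhs_left_lt.
apply: cvg_lim => //.
have Bt : B s w @[s --> t^'-] --> B t w.
  apply: cvg_at_left_filter.
  have [+ _] := (continuous_within_itvcyP _ _).1 (Bc w); apply.
  by rewrite in_itv/= t0.
apply: cvg_trans (cvgB (cvgD (cvg_cst (xi w)) Bt) (M_left_is_cvg (t := t) lm)).
apply: near_eq_cvg; near=> s; rewrite X_ge0//.
near: s; exact: nbhs_left_ge.
Unshelve. all: by end_near. Qed.

(** Stated for any supersolution [l] of the equation started from [xi - e]; the gap [e] drives a
    first-crossing argument. *)
Lemma physical_solution_le xi e L l t : measurable_fun setT xi ->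
  physical_solution alpha B xi L -> M l -> 0 < e ->
  (forall s, Gamma alpha B (fun w => xi w - e) l s <= l s) -> L t <= l t.
Proof.
move=> mxi [Lsol Lphys] lM e0 lsuper; have [LM _] := Lsol.
have [_ L0 Lm] := LM; have [_ l0 lm] := lM.
have mxie : measurable_fun setT (fun w => xi w - e) by exact: measurable_funB.
(* Bootstrap: a bound with room [e] improves to one without, since it orders the particles of the
   two systems. *)
have before s : (forall r, 0 <= r <= s -> L r < l r + e) -> L s <= l s.
  move=> H; rewrite (solution_Gamma s Lsol); apply: le_trans (lsuper s).
  apply: Gamma_le => //; apply: subset_hit => // w r /H; lra.
pose E := [set r | 0 <= r /\ l r + e <= L r].
have [E0|/set0P/negP] := pselect (E !=set0); last first.
  move=> /negPn/eqP E0; apply: before => r /andP[r0 _]; rewrite ltNge.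
  by apply/negP => rE; have : E r by []; rewrite E0.
exfalso.
have lE : has_lbound E by exists 0 => r [].
pose t0 := inf E.
have t0_ge0 : 0 <= t0 by apply: lb_le_inf => // r [].
(* The infimum belongs to [E]: a strict gap at [t0] would persist just after it, [L] being
   right-continuous and [l] nondecreasing. *)
have t0E : l t0 + e <= L t0.
  rewrite leNgt; apply/negP => gap.
  have gap0 : 0 < l t0 + e - L t0 by rewrite subr_gt0.
  have [u tu Lu] := M_right t0 LM gap0.
  have ut : 0 < u - t0 by rewrite subr_gt0.
  have [r [r0 rE] ru] := inf_adherent ut (conj E0 lE).
  have tr : t0 <= r by apply: ge_inf.
  have : L r <= L u by apply: Lm; move: ru; rewrite -/t0; lra.
  have := lm _ _ tr; lra.
have below s : s < t0 -> L s <= l s.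
  move=> st; apply: before => r /andP[r0 rs]; rewrite ltNge; apply/negP => rE.
  by have : t0 <= r; [exact: ge_inf|lra].
pose q := left_limit L t0.
have ql : q <= l t0.
  apply: left_limit_le => // s st.
  exact: le_trans (below s st) (lm _ _ (ltW st)).
(* The part of the jump of [L] that reaches the level [l t0 + e]; it is at least [e] because
   [q <= l t0]. *)
pose x := l t0 + e - q.
have jump : x <= L t0 - q by rewrite /x; lra.
pose C c := [set w | (t0%:E <= tau B xi L w)%E /\
        0 < left_limit (fun s => X B xi L s w) t0 <= c].
have mC c : measurable (C c).
  rewrite (_ : C c = [set w | (t0%:E <= tau B xi L w)%E] `&`
      [set w | `]0, c]%classic (xi w + B t0 w - q)]).
    by apply: measurableI; [exact: measurable_le_tau|exact: measurable_path].
  by apply: eq_set => w; rewrite left_limit_X// /= in_itv.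
(* Such a [c] is below the jump, which is the infimum in the physical condition, so [c] violates the
   strict inequality there. *)
have Cphys c : 0 < c < x -> c <= alpha * p (C c).
  move=> /andP[c0 cx]; rewrite leNgt; apply/negP => Cc.
  have := Lphys t0 t0_ge0; rewrite -/q => jumpE.
  have : L t0 - q <= c by rewrite jumpE; apply: ge_inf => //; exists 0 => r [/ltW].
  lra.
(* Every particle with X_{t0-} <= x is absorbed by time t0 in the system
   started from xi - e, since l t0 = x + q - e. *)
have main c s : 0 < c < x -> s < t0 -> L s + c <= l t0.
  move=> cx st; apply: le_trans (lsuper t0); rewrite Gamma_hit//.
  rewrite (solution_Gamma s Lsol) Gamma_hit//.
  have mh : measurable (hit xi L s) by exact: measurable_hit.
  apply: le_trans (lerD (lexx _) (Cphys c cx)) _.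
  (* Particles absorbed by [s < t0] are disjoint from those alive up to [t0], so the masses add. *)
  rewrite -mulrDr ler_pM2l// -p_add//; last first.
    apply/disj_setPS => w [[r /andP[r0 rs] Yr] [/le_tau tt _]].
    by have := tt r; rewrite r0/= (le_lt_trans rs st) => /(_ isT); lra.
  apply: p_le; [exact: measurableU|exact: measurable_hit|].
  move=> w [[r /andP[r0 rs] Yr]|[_]].
    by exists r; [lra|]; have := below r (le_lt_trans rs st); lra.
  rewrite left_limit_X// -/q => Yt; exists t0; first by rewrite t0_ge0 lexx.
  by move: cx Yt; rewrite /x; lra.
(* Letting [s] increase to [t0] and [c] to [x] in [main] gives this bound, which unfolds to
   [e <= 0]. *)
have : q + x <= l t0.
  rewrite -lerBrDr; apply: left_limit_le => // s st; rewrite lerBrDr.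
  rewrite -lerBrDl; apply/ler_addgt0Pr => c c0.
  have m0 : 0 < Num.min c (x / 2) by rewrite lt_min c0 /x; lra.
  have mc : Num.min c (x / 2) <= c by rewrite ge_min lexx.
  have mx : Num.min c (x / 2) <= x / 2 by rewrite ge_min lexx orbT.
  have := main (x - Num.min c (x / 2)) s; rewrite st => /(_ _ isT).
  by move=> H; have := H ltac:(lra); lra.
rewrite /x; lra.
Qed.

End mckean_vlasov.

Theorem theorem1p7 (R : realType) (d : measure_display) (T : measurableType d)
    (P : probability T R) (alpha : R) (alpha_gt0 : 0 < alpha)
    (X0 : {RV P >-> R}) (B : R -> {RV P >-> R})
    (BM : brownian_motion B) (X0_indep_B : independent_of_process X0 B)
    (X0_integrable : P.-integrable [set: T] (EFin \o X0))
    (Lmin : R -> R -> R)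
    (Lmin_minimal : forall x : R,
       minimal_solution alpha B (fun w => X0 w + x) (Lmin x))
    (L0 : R -> R) (L0_cadlag : cadlag L0)
    (L0_left_limit : M1_cvg (0 : R)^'- Lmin L0) :
  (forall L : R -> R, physical_solution alpha B X0 L ->
     forall t : R, 0 <= t -> L t <= L0 t) /\
  ((exists L1 L2 : R -> R, [/\ physical_solution alpha B X0 L1,
      physical_solution alpha B X0 L2 & L1 <> L2]) ->
   L0 <> Lmin 0).
Proof.
have [B0 Bc _ _] := BM.
have mX x : measurable_fun setT (fun w => X0 w + x) by exact: measurable_funD.
have LminM x : M (Lmin x) by exact: minimal_solution_M (Lmin_minimal x).
have L0M : M L0 by exact: M1_cvg_M L0_left_limit LminM L0_cadlag.
have physical_le_L0 L : physical_solution alpha B X0 L ->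
    forall t, 0 <= t -> L t <= L0 t.
  move=> Lphys t t0; have [[LM _] _] := Lphys; have [_ _ Lm] := LM.
  have L_le x s : x < 0 -> L s <= Lmin x s.
    (* Half of the shift makes [Lmin x] a supersolution started from [X0 + x / 2]; the other half is
       the gap for the comparison with [L]. *)
    move=> x0; have e0 : 0 < - x / 2 by lra.
    apply: (physical_solution_le alpha_gt0 B0 Bc s _ Lphys (LminM x) e0) => //.
    move=> r.
    rewrite (_ : (fun w => _) = (fun w => X0 w + x + (- x / 2))).
      exact: minimal_solution_supersolution (Lmin_minimal x) e0.
    by apply/funext => w; lra.
  apply: le_of_right => [e e0|u tu]; first exact: M_right.
  apply/ler_addgt0Pr => e e0.
  have m0 : 0 < Num.min e (u - t) by rewrite lt_min e0 subr_gt0.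
  have me : Num.min e (u - t) <= e by rewrite ge_min lexx.
  have mu : Num.min e (u - t) <= u - t by rewrite ge_min lexx orbT.
  have uN1 : -1 <= u by lra.
  have [x [x0 /andP[Hx _]]] := filter_ex (filterI (nbhs_left_lt (0 : R))
    (M1_cvg_bounds L0_left_limit LminM uN1 m0)).
  have := L_le x (u - Num.min e (u - t)) x0.
  have : L t <= L (u - Num.min e (u - t)) by apply: Lm; lra.
  lra.
split=> // -[L1 [L2 [phys1 phys2 L12]]] L0E; apply: L12.
have X0E : (fun w => X0 w + 0) = X0 by apply/funext => w; rewrite addr0.
have min0 := Lmin_minimal 0; rewrite X0E -L0E in min0.
(* If [L0] is also the minimal solution, it bounds each physical solution from both sides. *)
have unique L : physical_solution alpha B X0 L -> L = L0.
  move=> Lphys; have [Lsol _] := Lphys; apply/funext => t.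
  have [t0|t0] := ltP t 0.
    by have [[_ -> // _] _] := Lsol; have [_ -> // _] := L0M.
  apply/eqP; rewrite eq_le physical_le_L0//=.
  exact: (minimal_solution_le alpha_gt0 Bc t _ min0 Lsol).
by rewrite (unique L1)// (unique L2).
Qed.
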